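(* Let $f,g,h:[a,b]\to\mathbb{R}$ be measurable functions. If there exist constants $M\ge m>0$ and $N\ge n>0$ such that $h(x)\ge0$, $Mh(x)\ge f(x)\ge mh(x)$ and $Nh(x)\ge g(x)\ge nh(x)$ for almost every $x\in[a,b]$, then $$\left|\widehat{\mathcal{P}}_h(f,g)\right|\le\frac14\cdot\frac{M-m}{\sqrt{mM}}\cdot\frac{N-n}{\sqrt{Nn}}\left|\int_a^b h(x)f(x)\,dx\right|\left|\int_a^b h(x)g(x)\,dx\right|.$$
   Context: For real functions $f,g,h$ on $[a,b]$ ($a<b$), the (generalized Pompeiu–Chebyshev) functional is $$\widehat{\mathcal{P}}_h(f,g)=\int_a^b h^2(x)\,dx\int_a^b f(t)g(t)\,dt-\int_a^b f(t)h(t)\,dt\int_a^b h(x)g(x)\,dx.$$ All integrals occurring in the statement are assumed to exist and be finite (equivalently, $h^2$ is integrable on $[a,b]$). *)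

(* Defs.v *)
From mathcomp Require Export all_boot all_order all_algebra.
From mathcomp Require Export all_classical all_reals all_analysis measurable_realfun.
Export Order.TTheory GRing.Theory Num.Theory.
Export numFieldNormedType.Exports.

Set Implicit Arguments.
Unset Strict Implicit.
Unset Printing Implicit Defensive.

Local Open Scope classical_set_scope.
Local Open Scope ring_scope.

(* The carrier R with the sigma-algebra of Lebesgue (not merely Borel)
   measurable sets, on which [completed_lebesgue_measure] is defined. *)
Notation lebesgueType R :=
  (@caratheodory_type R%type (ocitv_type R%type)
    ((wlength idfun)^*)%mu).

Definition lebesgue_measurable_on (R : realType) (D : set R) (f : R -> R) :=
  measurable_fun (D : set (lebesgueType R)) (f : lebesgueType R -> R).

Definition lebesgue_integrable_on (R : realType) (D : set R) (f : R -> R) :=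
  (@completed_lebesgue_measure R).-integrable D (EFin \o f).

(* [Rintegral] is the real part of the extended-real integral, hence 0 when the
   latter is infinite. *)
Definition lebesgue_int (R : realType) (a b : R) (f : R -> R) : R :=
  Rintegral (@completed_lebesgue_measure R) `[a, b] f.

Definition pompeiu_chebyshev (R : realType) (a b : R) (h f g : R -> R) : R :=
  lebesgue_int a b (fun x => h x ^+ 2) * lebesgue_int a b (fun t => f t * g t)
  - lebesgue_int a b (fun t => f t * h t) * lebesgue_int a b (fun x => h x * g x).

(* Main.v *)
Require Import Defs.
From mathcomp Require Import ring.

(** Write <u, v> for the integral of u v over [a, b].  The functional
    <h, h> <f, g> - <f, h> <h, g> is, up to the factor <h, h>, the inner product
    of the components of f and g orthogonal to h.  Cauchy-Schwarz for these
    components (a consequence of the positivity of the Gram matrix of f, g, h)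
    gives
      (<h, h> <f, g> - <f, h> <h, g>)^2
        <= (<h, h> <f, f> - <f, h>^2) (<h, h> <g, g> - <g, h>^2),
    which is [gram_defect_sqr_le].  So it remains to bound each factor, where f
    and g no longer interact.  Integrating (f - m h) (M h - f) >= 0 gives
    <f, f> + m M <h, h> <= (m + M) <f, h> ([Rintegral_sqr_le]), and completing a
    square turns this into the reverse Cauchy-Schwarz bound
      <h, h> <f, f> - <f, h>^2 <= (M - m)^2 / (4 m M) <f, h>^2
    ([gram_defect_le]).  The product of the square roots of the two bounds is
    the right-hand side; the constant 1/4 is the product of two halves.  When
    <h, h> = 0 the orthogonal components make no sense, but then <f, h> and
    <g, h>, which lie between multiples of <h, h>, vanish and so does
    everything.

    All products of f, g and h are dominated by multiples of h^2, hence
    integrable.  The bounds hold off a null set, and integrals over [a, b] are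
    unchanged when that null set is removed, so the measure-theoretic argument
    is carried out on a set where they hold at every point
    ([pompeiu_gruss_on]). *)

Set Implicit Arguments.
Unset Strict Implicit.
Unset Printing Implicit Defensive.

Local Open Scope classical_set_scope.
Local Open Scope ring_scope.

(** * Gram determinants *)

(** For s = V the form is least at t = -W, and its value there is
    V (U V - W^2).  When V = 0 this carries no information, but the form is then
    affine in t, which forces W = 0. *)
Lemma sqr_le_mul_of_form_ge0 (R : realFieldType) (U W V : R) :
  (forall s t, 0 <= s ^+ 2 * U + 2 * (s * t) * W + t ^+ 2 * V) ->
  W ^+ 2 <= U * V.
Proof.
move=> form_ge0; have := form_ge0 0 1.
rewrite expr0n /= !mul0r mulr0 mul0r !add0r expr1n mul1r le_eqVlt.
case/orP => [/eqP V0|V_gt0].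
  have := form_ge0 W (- (U + 1) / 2); rewrite -V0 !mulr0.
  have -> : W ^+ 2 * U + 2 * (W * (- (U + 1) / 2)) * W + 0 = - W ^+ 2 by field.
  by rewrite oppr_ge0.
have := form_ge0 V (- W).
have -> : V ^+ 2 * U + 2 * (V * - W) * W + (- W) ^+ 2 * V =
  V * (U * V - W ^+ 2) by ring.
by rewrite pmulr_rge0// subr_ge0.
Qed.

(** The hypothesis says that the Gram matrix of three vectors f, g, h is positive
    semidefinite, with ff, fg and so on standing for its entries.  The form is
    restricted to the combinations of f and g made orthogonal to h; clearing the
    denominator hh in the orthogonal projection gives the coefficients used. *)
Lemma gram_defect_sqr_le (R : realFieldType) (ff gg hh fg fh gh : R) :
  0 < hh ->
  (forall x y z, 0 <= x ^+ 2 * ff + y ^+ 2 * gg + z ^+ 2 * hh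
     + 2 * (x * y) * fg + 2 * (x * z) * fh + 2 * (y * z) * gh) ->
  (hh * fg - fh * gh) ^+ 2 <= (hh * ff - fh ^+ 2) * (hh * gg - gh ^+ 2).
Proof.
move=> hh_gt0 gram_ge0; apply: sqr_le_mul_of_form_ge0 => s t.
rewrite -(pmulr_rge0 _ hh_gt0).
have := gram_ge0 (s * hh) (t * hh) (- (s * fh + t * gh)).
by congr (0 <= _); ring.
Qed.

(** The difference of the two sides, multiplied by 4 m M, is the square of
    (m + M) fh - 2 m M hh plus a nonnegative multiple of the slack in the
    hypothesis on ff: this is AM-GM for (m + M) fh and 2 m M hh. *)
Lemma gram_defect_le (R : rcfType) (m M ff hh fh : R) :
  0 < m -> m <= M -> 0 <= hh -> ff + m * M * hh <= (m + M) * fh ->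
  hh * ff - fh ^+ 2 <= ((M - m) / (2 * Num.sqrt (m * M)) * fh) ^+ 2.
Proof.
move=> m_gt0 mM hh_ge0 ff_le.
have mM_gt0 : 0 < m * M by rewrite mulr_gt0// (lt_le_trans m_gt0).
have mM4_gt0 : 0 < 4 * (m * M) by rewrite mulr_gt0// ltr0n.
have -> : ((M - m) / (2 * Num.sqrt (m * M)) * fh) ^+ 2 =
    (M - m) ^+ 2 * fh ^+ 2 / (4 * (m * M)).
  rewrite exprMn expr_div_n [in LHS](exprMn 2) sqr_sqrtr ?ltW// mulrAC.
  by congr (_ / (_ * _)); ring.
rewrite ler_pdivlMr// -subr_ge0.
set gap := (m + M) * fh - (ff + m * M * hh).
have gap_ge0 : 0 <= 4 * (m * M) * (hh * gap).
  by rewrite mulr_ge0 ?(ltW mM4_gt0)// mulr_ge0// subr_ge0.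
rewrite (_ : _ - _ = 4 * (m * M) * (hh * gap)
  + ((m + M) * fh - 2 * (m * M) * hh) ^+ 2); last by rewrite /gap; ring.
by rewrite addr_ge0// sqr_ge0.
Qed.

(** The inequality depends on f, g, h only through their Gram matrix, so the
    integrals enter here as bare numbers. *)
Lemma gruss_of_gram (R : rcfType) (m M n N ff gg hh fg fh gh : R) :
  0 < m -> m <= M -> 0 < n -> n <= N -> 0 <= hh ->
  m * hh <= fh <= M * hh -> n * hh <= gh <= N * hh ->
  ff + m * M * hh <= (m + M) * fh ->
  gg + n * N * hh <= (n + N) * gh ->
  (forall x y z, 0 <= x ^+ 2 * ff + y ^+ 2 * gg + z ^+ 2 * hh
     + 2 * (x * y) * fg + 2 * (x * z) * fh + 2 * (y * z) * gh) ->
  `|hh * fg - fh * gh| <=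
    1 / 4 * ((M - m) / Num.sqrt (m * M)) * ((N - n) / Num.sqrt (N * n))
    * `|fh| * `|gh|.
Proof.
move=> m_gt0 mM n_gt0 nN; rewrite le_eqVlt => /orP[/eqP <-|hh_gt0].
  (* With hh = 0 the sandwich bounds read 0 <= fh <= 0 and 0 <= gh <= 0. *)
  rewrite !mulr0 -!eq_le => /eqP <- /eqP <- _ _ _.
  by rewrite mulr0 mul0r subrr normr0 !mulr0.
move=> /andP[fh_ge _] /andP[gh_ge _] ff_le gg_le gram_ge0.
have fh_ge0 : 0 <= fh by apply: le_trans fh_ge; rewrite mulr_ge0 ?ltW.
have gh_ge0 : 0 <= gh by apply: le_trans gh_ge; rewrite mulr_ge0 ?ltW.
rewrite (ger0_norm fh_ge0) (ger0_norm gh_ge0).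
have dff := gram_defect_le m_gt0 mM (ltW hh_gt0) ff_le.
have dgg := gram_defect_le n_gt0 nN (ltW hh_gt0) gg_le.
have dff_ge0 : 0 <= hh * ff - fh ^+ 2.
  rewrite -(pmulr_rge0 _ hh_gt0); have := gram_ge0 hh 0 (- fh).
  by congr (0 <= _); ring.
have dgg_ge0 : 0 <= hh * gg - gh ^+ 2.
  rewrite -(pmulr_rge0 _ hh_gt0); have := gram_ge0 0 hh (- gh).
  by congr (0 <= _); ring.
have := le_trans (gram_defect_sqr_le hh_gt0 gram_ge0)
  (ler_pM dff_ge0 dgg_ge0 dff dgg).
have half_ratio_ge0 (p P : R) : p <= P ->
    0 <= (P - p) / (2 * Num.sqrt (p * P)).
  by move=> pP; rewrite divr_ge0 ?subr_ge0// mulr_ge0 ?sqrtr_ge0.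
have c_ge0 := mulr_ge0 (half_ratio_ge0 m M mM) fh_ge0.
have d_ge0 := mulr_ge0 (half_ratio_ge0 n N nN) gh_ge0.
rewrite -exprMn -real_normK ?num_real ?ler_sqr ?nnegrE ?(mulr_ge0 c_ge0 d_ge0)//.
move/le_trans; apply; rewrite (mulrC N n).
have sqrt_neq0 (p P : R) : 0 < p -> p <= P -> Num.sqrt (p * P) != 0.
  by move=> p_gt0 pP; rewrite gt_eqF// sqrtr_gt0 mulr_gt0// (lt_le_trans p_gt0).
rewrite le_eqVlt; apply/orP; left; apply/eqP; field.
by rewrite !sqrt_neq0.
Qed.

(** * Integrals over a set where the bounds hold pointwise *)

Section on_a_measurable_set.
Context d (T : measurableType d) (R : realType).
Context (mu : {measure set T -> \bar R}) (D : set T) (mD : measurable D).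
Implicit Types f g h u v : T -> R.

Local Notation integrable_fun u := (mu.-integrable D (EFin \o u)).

Lemma integrable_add u v : integrable_fun u -> integrable_fun v ->
  integrable_fun (fun x => u x + v x).
Proof. exact: integrableD. Qed.

Lemma integrable_scale (k : R) u : integrable_fun u ->
  integrable_fun (fun x => k * u x).
Proof. exact: integrableZl. Qed.

(** The form is the integral of (x f + y g + z h)^2, expanded. *)
Lemma Rintegral_gram_ge0 f g h :
  integrable_fun (fun x => f x ^+ 2) -> integrable_fun (fun x => g x ^+ 2) ->
  integrable_fun (fun x => h x ^+ 2) -> integrable_fun (fun x => f x * g x) ->
  integrable_fun (fun x => f x * h x) -> integrable_fun (fun x => h x * g x) ->
  forall x y z : R,
  0 <= x ^+ 2 * (\int[mu]_(t in D) (f t ^+ 2))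
     + y ^+ 2 * (\int[mu]_(t in D) (g t ^+ 2))
     + z ^+ 2 * (\int[mu]_(t in D) (h t ^+ 2))
     + 2 * (x * y) * (\int[mu]_(t in D) (f t * g t))
     + 2 * (x * z) * (\int[mu]_(t in D) (f t * h t))
     + 2 * (y * z) * (\int[mu]_(t in D) (h t * g t)).
Proof.
move=> iff igg ihh ifg ifh ihg x y z.
rewrite -!RintegralZl// -!RintegralD//;
  try by do ?apply: integrable_add; apply: integrable_scale.
apply: Rintegral_ge0 => t _.
by rewrite (_ : _ + _ = (x * f t + y * g t + z * h t) ^+ 2) ?sqr_ge0//; ring.
Qed.

Lemma integrable_mul_of_le u v h (M N : R) :
  measurable_fun D u -> measurable_fun D v ->
  integrable_fun (fun x => h x ^+ 2) ->
  (forall x, D x -> 0 <= u x <= M * h x) ->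
  (forall x, D x -> 0 <= v x <= N * h x) ->
  integrable_fun (fun x => u x * v x).
Proof.
move=> mu_ mv ihh hu hv.
apply: (@le_integrable _ _ _ _ _ mD _ (EFin \o fun x => M * N * h x ^+ 2)).
- by apply/measurable_EFinP; exact: measurable_funM.
- move=> x Dx /=; rewrite lee_fin.
  have /andP[u0 uM] := hu x Dx; have /andP[v0 vN] := hv x Dx.
  rewrite ger0_norm ?mulr_ge0// (le_trans _ (ler_norm _))//.
  by rewrite (_ : M * N * _ = (M * h x) * (N * h x)) ?ler_pM//; ring.
- exact: integrable_scale.
Qed.

(** This is the integral of (f - m h) (M h - f) >= 0. *)
Lemma Rintegral_sqr_le f h (m M : R) :
  integrable_fun (fun x => f x ^+ 2) -> integrable_fun (fun x => h x ^+ 2) ->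
  integrable_fun (fun x => f x * h x) ->
  (forall x, D x -> m * h x <= f x <= M * h x) ->
  \int[mu]_(x in D) (f x ^+ 2) + m * M * (\int[mu]_(x in D) (h x ^+ 2))
    <= (m + M) * \int[mu]_(x in D) (f x * h x).
Proof.
move=> iff ihh ifh hf.
rewrite -!RintegralZl// -RintegralD//; last exact: integrable_scale.
apply: le_Rintegral => //; [|exact: integrable_scale|].
  by apply: integrable_add => //; exact: integrable_scale.
move=> x Dx; have /andP[mf fM] := hf x Dx.
rewrite -subr_ge0 (_ : _ - _ = (f x - m * h x) * (M * h x - f x)); last by ring.
by rewrite mulr_ge0 ?subr_ge0.
Qed.

Lemma Rintegral_mul_bounds f h (m M : R) :
  integrable_fun (fun x => h x ^+ 2) -> integrable_fun (fun x => f x * h x) ->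
  (forall x, D x -> 0 <= h x) ->
  (forall x, D x -> m * h x <= f x <= M * h x) ->
  m * (\int[mu]_(x in D) (h x ^+ 2)) <= \int[mu]_(x in D) (f x * h x)
    <= M * (\int[mu]_(x in D) (h x ^+ 2)).
Proof.
move=> ihh ifh h0 hf; rewrite -!RintegralZl//.
apply/andP; split; apply: le_Rintegral => //; try exact: integrable_scale;
  move=> x Dx; have /andP[mf fM] := hf x Dx;
  by rewrite expr2 mulrA ler_wpM2r ?h0.
Qed.

(** Integrability of the products is part of the conclusion because removing a
    null set from the domain needs it. *)
Lemma pompeiu_gruss_on f g h (m M n N : R) :
  measurable_fun D f -> measurable_fun D g -> measurable_fun D h ->
  integrable_fun (fun x => h x ^+ 2) ->
  0 < m -> m <= M -> 0 < n -> n <= N ->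
  (forall x, D x -> [/\ 0 <= h x, m * h x <= f x <= M * h x
                      & n * h x <= g x <= N * h x]) ->
  [/\ integrable_fun (fun x => f x * g x), integrable_fun (fun x => f x * h x),
      integrable_fun (fun x => h x * g x) &
   `| \int[mu]_(x in D) (h x ^+ 2) * \int[mu]_(x in D) (f x * g x)
      - \int[mu]_(x in D) (f x * h x) * \int[mu]_(x in D) (h x * g x) |
   <= 1 / 4 * ((M - m) / Num.sqrt (m * M)) * ((N - n) / Num.sqrt (N * n))
      * `| \int[mu]_(x in D) (f x * h x) |
      * `| \int[mu]_(x in D) (h x * g x) |].
Proof.
move=> mf mg mh ihh m0 mM n0 nN bd.
have h_bd x : D x -> 0 <= h x <= 1 * h x.
  by move=> /bd[-> _ _]; rewrite mul1r lexx.
have f_bd x : D x -> 0 <= f x <= M * h x.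
  move=> /bd[h0 /andP[fm ->] _].
  by rewrite andbT (le_trans _ fm)// mulr_ge0// ltW.
have g_bd x : D x -> 0 <= g x <= N * h x.
  move=> /bd[h0 _ /andP[gn ->]].
  by rewrite andbT (le_trans _ gn)// mulr_ge0// ltW.
have iff : integrable_fun (fun x => f x ^+ 2) :=
  integrable_mul_of_le mf mf ihh f_bd f_bd.
have igg : integrable_fun (fun x => g x ^+ 2) :=
  integrable_mul_of_le mg mg ihh g_bd g_bd.
have ifg := integrable_mul_of_le mf mg ihh f_bd g_bd.
have ifh := integrable_mul_of_le mf mh ihh f_bd h_bd.
have ihg := integrable_mul_of_le mh mg ihh h_bd g_bd.
have igh := integrable_mul_of_le mg mh ihh g_bd h_bd.
have gh_sym : \int[mu]_(x in D) (g x * h x) = \int[mu]_(x in D) (h x * g x).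
  by apply: eq_Rintegral => x _; rewrite mulrC.
split=> //; apply: gruss_of_gram (Rintegral_gram_ge0 iff igg ihh ifg ifh ihg) => //.
- by apply: Rintegral_ge0 => x _; rewrite sqr_ge0.
- by apply: Rintegral_mul_bounds => // x /bd[].
- by rewrite -gh_sym; apply: Rintegral_mul_bounds => // x /bd[].
- by apply: Rintegral_sqr_le => // x /bd[].
- by rewrite -gh_sym; apply: Rintegral_sqr_le => // x /bd[].
Qed.

Lemma Rintegral_setD_null u (Z : set T) : measurable Z -> mu Z = 0%E ->
  measurable_fun D u -> mu.-integrable (D `\` Z) (EFin \o u) ->
  \int[mu]_(x in D) u x = \int[mu]_(x in D `\` Z) u x.
Proof.
move=> mZ Z0 mu_ iu; rewrite /Rintegral (negligible_integral mZ)//.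
by apply/(negligible_integrable mZ) => //; exact/measurable_EFinP.
Qed.

End on_a_measurable_set.

(** * Bounds that hold almost everywhere *)

Theorem theorem10 (R : realType) (a b : R) (hab : a < b) (f g h : R -> R)
  (mf : lebesgue_measurable_on `[a, b] f)
  (mg : lebesgue_measurable_on `[a, b] g)
  (mh : lebesgue_measurable_on `[a, b] h)
  (ih2 : lebesgue_integrable_on `[a, b] (fun x => h x ^+ 2))
  (M m N n : R) (hm : 0 < m) (hmM : m <= M) (hn : 0 < n) (hnN : n <= N)
  (hbound : {ae @completed_lebesgue_measure R, forall x : R, x \in `[a, b] ->
     [/\ 0 <= h x, m * h x <= f x <= M * h x & n * h x <= g x <= N * h x]}) :
  `| pompeiu_chebyshev a b h f g | <=
    1 / 4 * ((M - m) / Num.sqrt (m * M)) * ((N - n) / Num.sqrt (N * n))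
    * `| lebesgue_int a b (fun x => h x * f x) |
    * `| lebesgue_int a b (fun x => h x * g x) |.
Proof.
have mI : measurable (`[a, b]%classic : set (lebesgueType R)).
  exact: sub_caratheodory (measurable_itv _).
have [Z [mZ Z0 sub_Z]] := hbound.
pose E : set (lebesgueType R) := `[a, b]%classic `\` Z.
have mE : measurable E by exact: measurableD.
have sE : E `<=` `[a, b]%classic by exact: subDsetl.
have bdE x : E x ->
    [/\ 0 <= h x, m * h x <= f x <= M * h x & n * h x <= g x <= N * h x].
  move=> [xI nZx]; apply: contrapT => nbd.
  apply: nZx; apply: sub_Z => /= bx; apply: nbd; apply: bx.
  exact: xI.
have ihE : (@completed_lebesgue_measure R).-integrable E
    (EFin \o fun x => h x ^+ 2).
  by apply: integrableS ih2.
have [ifg ifh ihg bound] := pompeiu_gruss_on mE (measurable_funS mI sE mf)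
  (measurable_funS mI sE mg) (measurable_funS mI sE mh) ihE hm hmM hn hnN bdE.
have eqI u : lebesgue_measurable_on `[a, b] u ->
    (@completed_lebesgue_measure R).-integrable E (EFin \o u) ->
    lebesgue_int a b u = Rintegral (@completed_lebesgue_measure R) E u.
  by move=> mu_ iu; rewrite /lebesgue_int (Rintegral_setD_null mI mZ Z0).
have hfC : (fun x => h x * f x) = (fun x => f x * h x).
  by apply/funext => x; rewrite mulrC.
rewrite /pompeiu_chebyshev hfC.
by rewrite !eqI//; apply: measurable_funM.
Qed.
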